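(* Let $G=\mathbb{Z}/2\mathbb{Z}\star\mathbb{Z}/2\mathbb{Z}\star\mathbb{Z}/2\mathbb{Z}$, let $a,b,c$ be the non-identity elements of the three cyclic factors, and $\Sigma=\{a,b,c\}$. For $p\in(0,1/2)$ let $\mu_p$ be the probability measure with $\mu_p(a)=\mu_p(b)=p$, $\mu_p(c)=1-2p$. Let $h_p$ and $\gamma_p$ be the entropy and the drift (with respect to $\Sigma$) of the random walk $(G,\mu_p)$, and $v$ the volume of $G$ with respect to $\Sigma$. Then, for $p\in(0,1/2)$, $h_p/(\gamma_pv)=1$ if and only if $p=1/3$.
   Context: Random walk $(G,\mu)$: $X_0=1$, $X_{n+1}=X_nx_n$ with $(x_n)$ i.i.d. of law $\mu$. Let $|g|$ be the word length of $g\in G$ with respect to $\Sigma$. The drift is $\gamma=\lim_n|X_n|/n$ (a.s.). The entropy is $h=\lim_n-\frac1n\sum_{g\in G}\mu^{*n}(g)\log\mu^{*n}(g)$, where $\mu^{*n}$ is the $n$-th convolution power. The volume is $v=\lim_n\frac1n\log\#\{g\in G:|g|\le n\}$. *)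

(* Defs.v *)
From HB Require Import structures.
From mathcomp Require Import all_boot all_order all_algebra.
From mathcomp Require Import finmap.
From mathcomp Require Import all_classical all_reals all_analysis.

Set Implicit Arguments.
Unset Strict Implicit.
Unset Printing Implicit Defensive.

Import Order.TTheory GRing.Theory Num.Theory.
Import numFieldNormedType.Exports.

Local Open Scope classical_set_scope.
Local Open Scope ring_scope.

(** * The group Z/2 * Z/2 * Z/2

    Normal form construction of the free product: since each factor has a
    single non-identity element, a reduced word is a sequence of (indices of)
    factors without two equal consecutive terms. *)

Definition reduced (s : seq 'I_3) : bool := sorted (fun i j => i != j) s.

Record freeprod : Type := Freeprod { word : seq 'I_3; _ : reduced word }.

HB.instance Definition _ := [isSub for word].
HB.instance Definition _ := [Choice of freeprod by <:].

(* Left multiplication of the word s by the i-th letter, with reduction. *)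
Definition lmul_letter (i : 'I_3) (s : seq 'I_3) : seq 'I_3 :=
  if s is j :: t then if i == j then t else i :: s else [:: i].

Definition lmul_word (s t : seq 'I_3) : seq 'I_3 := foldr lmul_letter t s.

Lemma reduced_behead i s : reduced (i :: s) -> reduced s.
Proof. exact: path_sorted. Qed.

Lemma reduced_lmul_letter i s : reduced s -> reduced (lmul_letter i s).
Proof.
case: s => // j t Hs; rewrite /lmul_letter; case: eqP => [_|/eqP ij].
  exact: reduced_behead Hs.
by rewrite /reduced /= ij.
Qed.

Lemma reduced_lmul_word s t : reduced t -> reduced (lmul_word s t).
Proof. by move=> Ht; elim: s => //= i s; exact: reduced_lmul_letter. Qed.

Lemma reduced_rev s : reduced s -> reduced (rev s).
Proof.
rewrite /reduced rev_sorted; congr (is_true _).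
by apply: eq_sorted => i j; rewrite eq_sym.
Qed.

Lemma lmul_letterK i s : reduced s -> lmul_letter i (lmul_letter i s) = s.
Proof.
case: s => [_ |j t] /=; first by rewrite eqxx.
case: (i =P j) => [<-|_ _]; last by rewrite /= eqxx.
by case: t => //= k t /andP[/negbTE ->].
Qed.

Lemma lmul_word_letter i s t : reduced s -> reduced t ->
  lmul_word (lmul_letter i s) t = lmul_letter i (lmul_word s t).
Proof.
case: s => //= j s _ Ht; case: (i =P j) => [->|_] //=.
by rewrite lmul_letterK // reduced_lmul_word.
Qed.

Lemma lmul_wordA s t u : reduced t -> reduced u ->
  lmul_word s (lmul_word t u) = lmul_word (lmul_word s t) u.
Proof.
move=> Ht Hu; elim: s => //= i s ->.
by rewrite lmul_word_letter // reduced_lmul_word.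
Qed.

Lemma lmul_words0 s : reduced s -> lmul_word s [::] = s.
Proof.
elim: s => //= i s IH Hs; rewrite IH ?(reduced_behead Hs) //.
by case: s Hs {IH} => //= j s /andP[/negbTE ->].
Qed.

Lemma lmul_word_rev s : reduced s -> lmul_word (rev s) s = [::].
Proof.
elim: s => //= i s IH Hs.
rewrite rev_cons /lmul_word foldr_rcons /= eqxx.
exact: IH (reduced_behead Hs).
Qed.

Definition freeprod_one : freeprod := @Freeprod [::] isT.
Definition freeprod_mul (g h : freeprod) : freeprod :=
  Freeprod (reduced_lmul_word (word g) (valP h)).
Definition freeprod_inv (g : freeprod) : freeprod :=
  Freeprod (reduced_rev (valP g)).

Lemma freeprod_mulA : associative freeprod_mul.
Proof. by move=> g h k; apply: val_inj; apply: lmul_wordA; exact: valP. Qed.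

Lemma freeprod_mul1 : left_id freeprod_one freeprod_mul.
Proof. by move=> g; exact: val_inj. Qed.

Lemma freeprod_mulr1 : right_id freeprod_one freeprod_mul.
Proof. by move=> g; apply: val_inj; apply: lmul_words0; exact: valP. Qed.

Lemma freeprod_mulV : left_inverse freeprod_one freeprod_inv freeprod_mul.
Proof. by move=> g; apply: val_inj; apply: lmul_word_rev; exact: valP. Qed.

Lemma freeprod_mulrV : right_inverse freeprod_one freeprod_inv freeprod_mul.
Proof.
move=> g; apply: val_inj; rewrite /= -{1}(revK (word g)).
by apply: lmul_word_rev; apply: reduced_rev; exact: valP.
Qed.

HB.instance Definition _ := isGroup.Build freeprod
  freeprod_mulA freeprod_mul1 freeprod_mulr1 freeprod_mulV freeprod_mulrV.

(* The non-identity element of the i-th factor. *)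
Definition letter (i : 'I_3) : freeprod := @Freeprod [:: i] isT.

Definition gen_a : freeprod := letter (@Ordinal 3 0 isT).
Definition gen_b : freeprod := letter (@Ordinal 3 1 isT).
Definition gen_c : freeprod := letter (@Ordinal 3 2 isT).

Definition Sigma : set freeprod := [set gen_a; gen_b; gen_c].

Lemma letterE (i : 'I_3) : Sigma (letter i).
Proof.
case: i => -[|[|[|//]]] i3; [left; left|left; right|right];
  by congr letter; apply: val_inj.
Qed.

Lemma letter_sq i : (letter i * letter i = 1)%g.
Proof. by apply: val_inj; rewrite /= eqxx. Qed.

Lemma freeprod_prod g : g = (\prod_(i <- word g) letter i)%g.
Proof.
case: g => s Hs /=; elim: s Hs => [|i s IH] Hs.
  by rewrite big_nil; exact: val_inj.
rewrite big_cons -(IH (reduced_behead Hs)); apply: val_inj => /=.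
by case: s Hs {IH} => //= j s /andP[/negbTE ->].
Qed.

(* Universal property of the free product of three copies of Z/2: a morphism
   from Z/2 to H amounts to an element of H of square 1. *)
Lemma freeprod_universal (H : groupType) (f : 'I_3 -> H) :
  (forall i, f i * f i = 1)%g ->
  exists! phi : freeprod -> H,
    {morph phi : g h / (g * h)%g} /\ (forall i, phi (letter i) = f i).
Proof.
move=> f2; pose F s := (\prod_(i <- s) f i)%g.
have Fl i s : F (lmul_letter i s) = (f i * F s)%g.
  case: s => [|j s] /=; first by rewrite /F big_cons.
  case: (i =P j) => [->|_]; rewrite /F !big_cons //.
  by rewrite mulgA f2 mul1g.
exists (F \o word); split.
  split; last by move=> i; rewrite /F /= big_seq1.
  move=> g h /=; elim: (word g) => [|i s IH] /=.
    by rewrite {2}/F big_nil mul1g.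
  by rewrite Fl IH mulgA {3}/F big_cons.
move=> psi [psiM psif].
have psi1 : psi 1%g = 1%g.
  by apply: (mulgI (psi 1%g)); rewrite -psiM !mulg1.
apply/funext => g /=.
rewrite [in RHS](freeprod_prod g) /F.
elim: (word g) => [|i s IH]; first by rewrite !big_nil psi1.
by rewrite !big_cons psiM psif IH.
Qed.

(** * Word length and volume *)

Section WordLength.
Variables (G : groupType) (S : set G).

Definition is_product_of (n : nat) (g : G) : Prop :=
  exists s : seq G, [/\ size s = n,
    (forall x, x \in s -> S x \/ S (x^-1)%g) & g = (\prod_(x <- s) x)%g].

(* The least n such that g is a product of n elements of S or inverses of
   elements of S (and 0 if g is not in the subgroup generated by S). *)
Definition word_length (g : G) : nat :=
  xget 0%N [set n | is_product_of n g /\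
                    forall m, is_product_of m g -> (n <= m)%N].

(* The balls are finite when S is; [fset_set] would be empty otherwise. *)
Definition ball_card (n : nat) : nat :=
  #|` fset_set [set g : G | (word_length g <= n)%N] |.

Definition volume (R : realType) : R :=
  limn (fun n : nat => n%:R^-1 * ln (ball_card n)%:R).

End WordLength.

Lemma size_lmul_letter i s : (size (lmul_letter i s) <= (size s).+1)%N.
Proof. by case: s => //= j s; case: ifP => // _; rewrite leqW. Qed.

Lemma word_length_freeprod g : word_length Sigma g = size (word g).
Proof.
have Pg : is_product_of Sigma (size (word g)) g.
  exists [seq letter i | i <- word g]; split; first by rewrite size_map.
    by move=> x /mapP[i _ ->]; left; exact: letterE.
  by rewrite big_map -freeprod_prod.
have min_g m : is_product_of Sigma m g -> (size (word g) <= m)%N.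
  move=> [s [<- sS ->]].
  elim: s sS => [|x s IH] sS; first by rewrite big_nil.
  have [i ->] : exists i, x = letter i.
    have [] := sS x (mem_head _ _).
      by case=> [[->|->]|->]; eexists.
    by move=> Sx; rewrite -(invgK x); case: Sx => [[->|->]|->];
      eexists; apply: val_inj.
  rewrite big_cons; apply: leq_trans (size_lmul_letter _ _) _.
  by rewrite ltnS IH // => y ys; apply: sS; rewrite inE ys orbT.
rewrite /word_length; case: xgetP => [n _ [Pn min_n]|].
  by apply/eqP; rewrite eqn_leq min_n // min_g.
by move=> /(_ (size (word g)))[]; split.
Qed.

(** * Random walks

    A probability measure on a discrete group is represented by its mass
    function [mu : G -> R].  The finite-support sum [\sum_(h \in A) _] is
    the sum over the group as long as [mu] has finite support, in which case
    so do its convolution powers. *)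

Section RandomWalk.
Variables (R : realType) (G : groupType).

Definition convol (mu nu : G -> R) : G -> R :=
  fun g => \sum_(h \in [set: G]) mu h * nu (h^-1 * g)%g.

Fixpoint convol_pow (mu : G -> R) (n : nat) : G -> R :=
  if n is m.+1 then convol (convol_pow mu m) mu else fun g => (g == 1%g)%:R.

(* [ln 0 = 0], so elements of mass 0 contribute 0. *)
Definition entropy (mu : G -> R) : R :=
  limn (fun n : nat => - (n%:R^-1 *
    \sum_(g \in [set: G]) convol_pow mu n g * ln (convol_pow mu n g))).

Section Steps.
Context d (T : measurableType d) (P : probability T R).

(* All subsets of G are events, G carrying the discrete sigma-algebra. *)
Definition iid (mu : G -> R) (x : nat -> T -> G) : Prop :=
  [/\ forall n (A : set G), measurable (x n @^-1` A),
      forall n (g : G), P (x n @^-1` [set g]) = (mu g)%:E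
    & forall (J : {fset nat}) (A : nat -> set G),
        P (\bigcap_(j in [set` J]) (x j @^-1` A j)) =
        (\prod_(j <- J) P (x j @^-1` A j))%E].

Fixpoint walk (x : nat -> T -> G) (n : nat) (w : T) : G :=
  if n is m.+1 then (walk x m w * x m w)%g else 1%g.

Definition is_drift (S : set G) (x : nat -> T -> G) (gamma : R) : Prop :=
  {ae P, forall w : T,
    (fun n : nat => (word_length S (walk x n w))%:R / n%:R) @ \oo --> gamma}.

End Steps.
End RandomWalk.

Definition mu_abc (R : realType) (p : R) : freeprod -> R :=
  fun g => if (g == gen_a) || (g == gen_b) then p
           else if g == gen_c then 1 - 2 * p else 0.

(* Main.v *)
(** Let nu be the hitting measure on first letters of the limit of the walk and
    q = nu / (1 - nu) the letterwise hitting probabilities, so that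
    mu (1 - 2 nu) = kappa nu (1 - nu) with kappa = 1 - sum mu q the escape
    probability.  For p in (0, 1/2) one has nu = (s, s, 1 - 2s), where s is the
    root of 4 s^2 - (5 - 2p) s + 1 in (1/4, 1/2).

    With Q(g) the product of q over the letters of g, mu^n(g) <= Q(g), while Q
    has mass O(n) on the ball of radius n; by Gibbs' inequality the entropy of
    mu^n is E[- ln Q(X_n)] + O(ln n).  Both - ln Q and the word length are
    additive over letters, and the expected increment of such a function depends
    only on the probability that X_n ends with a given letter, which by symmetry
    of mu is the probability that X_n starts with it, and tends to nu because the
    harmonic function giving the probability that the limit starts with i differs
    from the indicator of X_n starting with i by at most Q(X_n).  Hence
      gamma = kappa sum nu (1 - nu)   and   h = kappa sum nu (1 - nu) (- ln q).
    Now gamma ln 2 - h is proportional to the relative entropy of the transition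
    probabilities nu_j / (1 - nu_i) of the limiting word with respect to 1/2, so
    it vanishes only for s = 1/3, that is p = 1/3. *)

Require Import Defs.
From HB Require Import structures.
From mathcomp Require Import all_boot all_order all_algebra.
From mathcomp Require Import finmap.
From mathcomp Require Import all_classical all_reals all_analysis.
From mathcomp Require Import measurable_realfun zify ring lra.

Set Implicit Arguments.
Unset Strict Implicit.
Unset Printing Implicit Defensive.

Import Order.TTheory GRing.Theory Num.Theory.
Import numFieldNormedType.Exports.

Local Open Scope classical_set_scope.
Local Open Scope ring_scope.

(** * Letters as involutions *)

Lemma letterKr i : cancel (fun g => (g * letter i)%g) (fun g => (g * letter i)%g).
Proof. by move=> g; rewrite -mulgA letter_sq mulg1. Qed.

Lemma letterV i : (letter i)^-1%g = letter i.
Proof. exact: val_inj. Qed.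

Lemma letter_inj : injective letter.
Proof. by move=> i j []. Qed.

Lemma word_inj : injective word.
Proof. exact: val_inj. Qed.

(** * Expectations along the walk *)

Section Expectation.
Variables (R : realType) (m : 'I_3 -> R).

Definition lstep (f : freeprod -> R) (g : freeprod) : R :=
  \sum_(i < 3) m i * f (letter i * g)%g.

Definition rstep (f : freeprod -> R) (g : freeprod) : R :=
  \sum_(i < 3) m i * f (g * letter i)%g.

(* The expectation of f (X_n).  The increments are exchangeable, so the walk
   may as well grow on the left, where reduction is by [lmul_letter]. *)
Definition expect (n : nat) (f : freeprod -> R) : R := iter n lstep f 1%g.

Lemma expectSr n f : expect n.+1 f = expect n (lstep f).
Proof. by rewrite /expect iterSr. Qed.

Lemma lstepC f : lstep (rstep f) = rstep (lstep f).
Proof.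
apply/funext => g; rewrite /lstep /rstep.
under eq_bigr do rewrite mulr_sumr.
rewrite exchange_big; apply: eq_bigr => i _; rewrite mulr_sumr.
by apply: eq_bigr => j _; rewrite mulgA mulrCA.
Qed.

(** Left and right steps commute by associativity and agree at 1, so the walk may also grow on the
    right. *)
Lemma expectS n f : expect n.+1 f = expect n (rstep f).
Proof.
rewrite /expect; have -> : iter n lstep (rstep f) = rstep (iter n lstep f).
  by elim: n => //= n ->; rewrite lstepC.
by rewrite iterS /lstep /rstep; apply: eq_bigr => i _; rewrite mulg1 mul1g.
Qed.

(** Letters are involutions, so inversion exchanges left and right steps: [X_n] and its inverse have
    the same law. *)
Lemma expect_inv n f : expect n (fun g => f (g^-1)%g) = expect n f.
Proof.
elim: n f => [|n IH] f; first by rewrite /expect /= invg1.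
rewrite expectS expectSr -[RHS]IH; congr (expect n _); apply/funext => g.
by apply: eq_bigr => i _; rewrite invgM letterV.
Qed.

Lemma expectD n f g : expect n (fun x => f x + g x) = expect n f + expect n g.
Proof.
elim: n f g => // n IH f g; rewrite !expectSr -IH; congr (expect n _).
by apply/funext => x; rewrite -big_split; apply: eq_bigr => i _; rewrite mulrDr.
Qed.

Lemma expectZ n c f : expect n (fun x => c * f x) = c * expect n f.
Proof.
elim: n f => // n IH f; rewrite !expectSr -IH; congr (expect n _).
by apply/funext => x; rewrite mulr_sumr; apply: eq_bigr => i _; rewrite mulrCA.
Qed.

Lemma expectB n f g : expect n (fun x => f x - g x) = expect n f - expect n g.
Proof.
rewrite expectD; congr (_ + _); rewrite -mulN1r -expectZ.
by congr (expect n _); apply/funext => x; rewrite mulN1r.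
Qed.

Lemma expect_sum n (I : Type) (r : seq I) (F : I -> freeprod -> R) :
  expect n (fun x => \sum_(i <- r) F i x) = \sum_(i <- r) expect n (F i).
Proof.
elim: r => [|i r IH].
  rewrite big_nil -[RHS](mul0r (expect n (fun=> 0))) -[RHS]expectZ.
  by congr (expect n _); apply/funext => x; rewrite big_nil mul0r.
rewrite big_cons -IH -expectD; congr (expect n _).
by apply/funext => x; rewrite big_cons.
Qed.

Lemma size_word_lmul i g : (size (word (letter i * g)%g) <= (size (word g)).+1)%N.
Proof. exact: size_lmul_letter. Qed.

(** After [n] steps the walk is in the ball of radius [n], which reduces every expectation to a
    finite sum. *)
Lemma eq_expect_ball n f f' :
  (forall g, (size (word g) <= n)%N -> f g = f' g) -> expect n f = expect n f'.
Proof.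
elim: n f f' => [|n IH] f f' ff'; first exact: ff'.
rewrite !expectSr; apply: IH => g gn; apply: eq_bigr => i _.
by rewrite ff' // (leq_trans (size_word_lmul _ _)).
Qed.

Hypothesis m_ge0 : forall i, 0 <= m i.
Hypothesis m_sum : \sum_(i < 3) m i = 1.

Lemma expect_cst n c : expect n (fun=> c) = c.
Proof.
elim: n => // n IH; rewrite expectSr -[RHS]IH; congr (expect n _).
by apply/funext => g; rewrite /lstep -mulr_suml m_sum mul1r.
Qed.

Lemma ler_lstep f f' : (forall g, f g <= f' g) -> forall g, lstep f g <= lstep f' g.
Proof. by move=> ff' g; apply: ler_sum => i _; exact: ler_wpM2l. Qed.

Lemma ler_expect n f f' : (forall g, f g <= f' g) -> expect n f <= expect n f'.
Proof.
elim: n f f' => [|n IH] f f' ff'; first exact: ff'.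
by rewrite !expectSr; apply: IH; exact: ler_lstep.
Qed.

Lemma ler_norm_expect n f : `|expect n f| <= expect n (fun g => `|f g|).
Proof.
rewrite ler_norml -mulN1r -expectZ; apply/andP; split; apply: ler_expect => g.
  by rewrite mulN1r lerNl -normrN ler_norm.
exact: ler_norm.
Qed.

End Expectation.

(** * Spheres and balls *)

Fixpoint sphere_words (n : nat) : seq (seq 'I_3) :=
  if n is k.+1 then
    [seq i :: s | s <- sphere_words k,
                  i <- [seq i <- enum 'I_3 | ohead s != Some i]]
  else [:: [::]].

Fixpoint ball_words (n : nat) : seq (seq 'I_3) :=
  if n is k.+1 then ball_words k ++ sphere_words n else sphere_words 0.

Definition word_ball (n : nat) : seq freeprod := pmap insub (ball_words n).

Lemma mem_sphere_words n s : (s \in sphere_words n) = reduced s && (size s == n).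
Proof.
elim: n s => [|n IH] s; first by rewrite inE; case: s => //= i s; rewrite andbF.
apply/allpairsPdep/idP => [[t [i []]]|].
  rewrite IH mem_filter mem_enum andbT => /andP[rt /eqP tn] ti ->.
  rewrite /= tn eqxx andbT; case: t rt ti {tn} => //= j t rt ji.
  by rewrite /reduced /= rt andbT; apply: contraNneq ji => ->.
case: s => // i s /andP[rs sn]; exists s, i; split=> //.
  by rewrite IH (reduced_behead rs).
rewrite mem_filter mem_enum andbT; case: s rs {sn} => //= j s /andP[ij _].
by apply: contraNneq ij => -[->].
Qed.

Lemma sphere_words_uniq n : uniq (sphere_words n).
Proof.
elim: n => //= n IH; apply: allpairs_uniq_dep => //.
- by move=> s _; rewrite filter_uniq // enum_uniq.
- by move=> [s i] [t j] _ _ /= [-> ->].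
Qed.

Lemma big_sphere_wordsS (V : nmodType) n (F : seq 'I_3 -> V) :
  \sum_(s <- sphere_words n.+1) F s =
  \sum_(s <- sphere_words n) \sum_(i | ohead s != Some i) F (i :: s).
Proof.
rewrite big_allpairs_dep; apply: eq_bigr => s _.
by rewrite big_filter big_enum_cond.
Qed.

Lemma ball_wordsS n : ball_words n.+1 = ball_words n ++ sphere_words n.+1.
Proof. by []. Qed.

Lemma mem_ball_words n s : (s \in ball_words n) = reduced s && (size s <= n)%N.
Proof.
elim: n => [|n IH]; first by rewrite (mem_sphere_words 0) leqn0.
rewrite ball_wordsS mem_cat (mem_sphere_words n.+1) IH -andb_orr.
by rewrite (leq_eqVlt _ n.+1) ltnS orbC.
Qed.

Lemma ball_words_uniq n : uniq (ball_words n).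
Proof.
elim: n => // n IH; rewrite ball_wordsS cat_uniq IH sphere_words_uniq andbT.
apply/hasPn => s; rewrite (mem_sphere_words n.+1 s) => /andP[_ /eqP sn] /=.
by rewrite mem_ball_words sn ltnn andbF.
Qed.

Lemma map_word_ball n : map word (word_ball n) = ball_words n.
Proof.
rewrite /word_ball (pmap_filter (insubK _)); apply/all_filterP/allP => s.
by rewrite mem_ball_words => /andP[rs _]; rewrite insubT.
Qed.

Lemma mem_word_ball n g : (g \in word_ball n) = (size (word g) <= n)%N.
Proof.
by rewrite -(mem_map word_inj) map_word_ball mem_ball_words (valP g).
Qed.

Lemma word_ball_uniq n : uniq (word_ball n).
Proof. by rewrite -(map_inj_uniq word_inj) map_word_ball ball_words_uniq. Qed.

Lemma size_sphere_words n : size (sphere_words n.+1) = (3 * 2 ^ n)%N.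
Proof.
rewrite -sum1_size; elim: n => [|n IH].
  by rewrite big_sphere_wordsS big_seq1 sum1_card card_ord.
rewrite big_sphere_wordsS expnSr mulnA -IH big_distrl /=.
rewrite big_seq [RHS]big_seq; apply: eq_bigr => s.
rewrite (mem_sphere_words n.+1); case: s => [|j s] //= _.
rewrite sum1_card mul1n [RHS](_ : 2%N = #|predC1 j|); last by rewrite cardC1 card_ord.
by apply: eq_card => i; rewrite !inE eq_sym.
Qed.

Lemma size_word_ball n : size (word_ball n) = (3 * 2 ^ n - 2)%N.
Proof.
rewrite -(size_map word) map_word_ball; elim: n => // n IH.
rewrite ball_wordsS size_cat IH size_sphere_words.
have : (0 < 2 ^ n)%N by rewrite expn_gt0.
by rewrite expnS; lia.
Qed.

Lemma ball_cardE n : ball_card Sigma n = size (word_ball n).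
Proof.
rewrite /ball_card; have -> : [set g | (word_length Sigma g <= n)%N] = [set` word_ball n].
  by apply/seteqP; split=> g /=; rewrite word_length_freeprod mem_word_ball.
apply/perm_size/uniq_perm => [||g]; rewrite ?fset_uniq ?word_ball_uniq //.
by rewrite in_fset_set; [rewrite mem_setE|exact: finite_seq].
Qed.

(** * The law of the walk *)

Definition letter_law (R : realType) (m : 'I_3 -> R) (g : freeprod) : R :=
  if word g is [:: i] then m i else 0.

Section Law.
Variables (R : realType) (m : 'I_3 -> R).

Definition mass (n : nat) (g : freeprod) : R :=
  expect m n (fun h => (h == g)%:R).

(** As letters are involutions, [h^-1 * g] is the letter [i] only for [h = g * letter i], so at most
    three terms survive. *)
Lemma sum_letter_law (F : freeprod -> R) g :
  \sum_(h \in [set: freeprod]) F h * letter_law m (h^-1 * g)%g =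
  \sum_(i < 3) m i * F (g * letter i)%g.
Proof.
pose r := [seq (g * letter i)%g | i <- enum 'I_3].
have injg : injective (fun i => (g * letter i)%g).
  by move=> i j /mulgI/letter_inj.
have ur : uniq r by rewrite map_inj_uniq ?enum_uniq.
rewrite -(@fsbig_widen _ _ _ _ [set` r]) //; last first.
  move=> h [_ /= hr]; rewrite /letter_law.
  case E : (word (h^-1 * g)%g) => [|i [|j s]]; rewrite ?mulr0 //.
  case: hr; apply/mapP; exists i; rewrite ?mem_enum //.
  have eh : letter i = (h^-1 * g)%g by apply: word_inj; exact: esym E.
  by apply: (mulgI h^-1%g); rewrite mulgA -eh letter_sq mulVg.
rewrite -fsbig_seq // big_map big_enum; apply: eq_bigr => i _.
rewrite mulrC; congr (_ * _); rewrite invgM letterV -mulgA mulVg mulg1.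
by [].
Qed.

Lemma massS n g :
  mass n.+1 g = \sum_(i < 3) m i * mass n (g * letter i)%g.
Proof.
rewrite /mass expectS /rstep expect_sum; apply: eq_bigr => i _.
rewrite expectZ; congr (_ * expect _ _ _).
apply/funext => h; congr ((nat_of_bool _)%:R).
by apply/eqP/eqP => [<-|->]; rewrite letterKr.
Qed.

Lemma convol_powE n g : convol_pow (letter_law m) n g = mass n g.
Proof.
elim: n g => [|n IH] g; first by rewrite /mass /expect /= eq_sym.
rewrite massS -sum_letter_law /= /convol.
by apply: eq_fsbigr => h _; rewrite IH.
Qed.

Lemma sum_ball n (f : freeprod -> R) :
  \sum_(g <- word_ball n) mass n g * f g = expect m n f.
Proof.
under eq_bigr do rewrite mulrC -expectZ.
rewrite -expect_sum; apply: eq_expect_ball => g gn.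
rewrite (bigD1_seq g) ?word_ball_uniq ?mem_word_ball //= eqxx mulr1 big1 ?addr0 // => h.
by rewrite eq_sym => /negbTE ->; rewrite mulr0.
Qed.

Lemma mass_eq0 n g : (n < size (word g))%N -> mass n g = 0.
Proof.
move=> ng; rewrite /mass (@eq_expect_ball _ _ _ _ (fun=> 0 * 0)).
  by rewrite expectZ mul0r.
by move=> h hn; case: eqP => [hg|]; rewrite ?mul0r //; move: ng; rewrite -hg ltnNge hn.
Qed.

Lemma entropy_sumE n :
  \sum_(g \in [set: freeprod])
     convol_pow (letter_law m) n g * ln (convol_pow (letter_law m) n g) =
  expect m n (fun g => ln (mass n g)).
Proof.
rewrite -sum_ball -(@fsbig_widen _ _ _ _ [set` word_ball n]) //.
  by rewrite -fsbig_seq ?word_ball_uniq //; apply: eq_bigr => g _; rewrite convol_powE.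
move=> g [_ /= /negP]; rewrite mem_word_ball -ltnNge => ng.
by rewrite convol_powE mass_eq0 // mul0r.
Qed.

End Law.

(** * Harmonic functions and the limits along the walk *)

Definition letter_prod (R : realType) (w : 'I_3 -> R) (g : freeprod) : R :=
  \prod_(i <- word g) w i.

Definition letter_sum (R : realType) (a : 'I_3 -> R) (g : freeprod) : R :=
  \sum_(i <- word g) a i.

Definition starts_with (i : 'I_3) (g : freeprod) : bool :=
  ohead (word g) == Some i.

Definition ends_with (i : 'I_3) (g : freeprod) : bool :=
  ohead (rev (word g)) == Some i.

Lemma ends_withV i g : ends_with i (g^-1)%g = starts_with i g.
Proof. by rewrite /ends_with /starts_with /= revK. Qed.

Section Potentials.
Variables (R : realType) (m : 'I_3 -> R).
Hypothesis m_ge0 : forall i, 0 <= m i.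
Hypothesis m_sum : \sum_(i < 3) m i = 1.

Lemma mass_ge0 n g : 0 <= mass m n g.
Proof.
by rewrite -[leLHS](expect_cst m_sum n) ler_expect // => h; rewrite ler0n.
Qed.

Lemma lstep_nil (F : seq 'I_3 -> R) g : word g = [::] ->
  lstep m (F \o word) g = \sum_(i < 3) m i * F [:: i].
Proof. by move=> g0; apply: eq_bigr => i _ /=; rewrite g0. Qed.

Lemma lstep_cons (F : seq 'I_3 -> R) g j s : word g = j :: s ->
  lstep m (F \o word) g =
  m j * F s + \sum_(i < 3 | i != j) m i * F [:: i, j & s].
Proof.
move=> gs; rewrite /lstep (bigD1 j) //= gs /= eqxx; congr (_ + _).
by apply: eq_bigr => i /negbTE /= ->.
Qed.

Lemma sum_neq (F : 'I_3 -> R) j :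
  \sum_(i < 3 | i != j) F i = \sum_(i < 3) F i - F j.
Proof. by rewrite [in RHS](bigD1 j) //= addrAC subrr add0r. Qed.

Lemma lstep_letter_prod1 (w : 'I_3 -> R) g : word g = [::] ->
  lstep m (letter_prod w) g = \sum_(i < 3) m i * w i.
Proof.
move=> g0; rewrite (lstep_nil (fun s => \prod_(i <- s) w i)) //.
by apply: eq_bigr => i _; rewrite big_seq1.
Qed.

(** A step by [j] cancels the first letter and divides the product by [w j]; a step by another
    letter [i] multiplies it by [w i]. *)
Lemma lstep_letter_prod (w : 'I_3 -> R) g j s : w j != 0 -> word g = j :: s ->
  lstep m (letter_prod w) g =
  letter_prod w g * (m j / w j - m j * w j + \sum_(i < 3) m i * w i).
Proof.
move=> wj gs; rewrite (lstep_cons (fun s => \prod_(i <- s) w i) gs).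
rewrite /letter_prod gs.
rewrite [X in _ + X](eq_bigr (fun i => (m i * w i) * \prod_(i <- j :: s) w i)) => [|i _].
  by rewrite -mulr_suml sum_neq big_cons; field.
by rewrite big_cons mulrA.
Qed.

(** A step by [i] adds [a i], unless [g] starts with [i], when the cancellation subtracts it. *)
Lemma lstep_letter_sum (a : 'I_3 -> R) g :
  lstep m (letter_sum a) g =
  letter_sum a g + \sum_(i < 3) m i * a i * (1 - 2 * (starts_with i g)%:R).
Proof.
case E : (word g) => [|j s].
  rewrite (lstep_nil (fun s => \sum_(i <- s) a i)) // /letter_sum E big_nil add0r.
  by apply: eq_bigr => i _; rewrite big_seq1 /starts_with E mulr0 subr0 mulr1.
rewrite (lstep_cons (fun s => \sum_(i <- s) a i) E) /letter_sum E.
rewrite [X in _ + X](eq_bigr (fun i =>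
    m i * a i + m i * \sum_(i <- j :: s) a i)); last first.
  by move=> i _; rewrite big_cons mulrDr.
rewrite big_split /= -mulr_suml !sum_neq m_sum big_cons.
rewrite [in RHS](bigD1 j) //= {1}/starts_with E eqxx.
rewrite [X in _ = _ + (_ + X)](eq_bigr (fun i => m i * a i)); last first.
  move=> i ij; rewrite /starts_with E (_ : _ == _ = false) ?mulr0 ?subr0 ?mulr1 //.
  by apply: contraNF ij => /eqP[->].
by rewrite sum_neq /=; ring.
Qed.

(** * Superharmonic letter products *)

Section Superharmonic.
Variables (w : 'I_3 -> R) (c : R).
Hypothesis w_gt0 : forall i, 0 < w i.
Hypothesis w_super : forall g, lstep m (letter_prod w) g <= c * letter_prod w g.

Lemma letter_prod_gt0 g : 0 < letter_prod w g.
Proof. by apply: prodr_gt0. Qed.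

Lemma expect_letter_prod_le n : 0 <= c -> expect m n (letter_prod w) <= c ^+ n.
Proof.
move=> c0; elim: n => [|n IH]; first by rewrite /expect /letter_prod /= big_nil.
rewrite expectSr exprS (le_trans (ler_expect m_ge0 _ w_super)) //.
by rewrite expectZ ler_wpM2l.
Qed.

(** The product at [h^-1 * g] dominates the indicator of [h = g]. A right step of [h] is a left step
    of [h^-1 * g], so its expectation does not increase with [n], and it starts at the product over
    [g]. *)
Lemma mass_le_letter_prod n g : c <= 1 -> mass m n g <= letter_prod w g.
Proof.
move=> c1; apply: (@le_trans _ _ (expect m n (fun h => letter_prod w (h^-1 * g)%g))).
  apply: ler_expect => // h; case: eqP => [->|_]; last exact/ltW/letter_prod_gt0.
  by rewrite mulVg /letter_prod big_nil.
elim: n => [|n IH]; first by rewrite /expect /= invg1 mul1g.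
rewrite expectS (le_trans _ IH) //; apply: ler_expect => // h; rewrite /rstep.
under eq_bigr do rewrite invgM letterV -mulgA.
rewrite (le_trans (w_super _)) // ler_piMl //; exact/ltW/letter_prod_gt0.
Qed.

End Superharmonic.
End Potentials.

(* [nu] is the hitting measure: [nu i] is the probability that the limit of the
   walk starts with the letter [i], and [q i] the probability of ever hitting
   [letter i]. *)
Section HarmonicMeasure.
Variables (R : realType) (m nu : 'I_3 -> R) (kappa : R).
Hypothesis m_gt0 : forall i, 0 < m i.
Hypothesis m_sum : \sum_(i < 3) m i = 1.
Hypothesis nu_gt0 : forall i, 0 < nu i.
Hypothesis nu_lt : forall i, nu i < 2^-1.
Hypothesis nu_sum : \sum_(i < 3) nu i = 1.
Hypothesis m_nu : forall i, m i * (1 - 2 * nu i) = kappa * (nu i * (1 - nu i)).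

Definition hit (i : 'I_3) : R := nu i / (1 - nu i).
Local Notation q := hit.
Local Notation Q := (letter_prod q).

Let m_ge0 i : 0 <= m i. Proof. exact: ltW. Qed.

Let nuC_gt0 i : 0 < 1 - nu i.
Proof. by have := nu_lt i; lra. Qed.

Lemma hit_gt0 i : 0 < q i. Proof. by rewrite divr_gt0. Qed.

Lemma hit_lt1 i : q i < 1.
Proof. by rewrite ltr_pdivrMr // mul1r; have := nu_lt i; lra. Qed.

Lemma kappa_gt0 : 0 < kappa.
Proof.
have : 0 < kappa * (nu ord0 * (1 - nu ord0)).
  by rewrite -m_nu mulr_gt0 //; have := nu_lt ord0; lra.
by rewrite pmulr_lgt0 // mulr_gt0.
Qed.

(** Together with [sum_hit] this makes the factor in [lstep_letter_prod] equal to 1, whatever the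
    first letter. *)
Lemma hit_kappa i : m i / q i - m i * q i = kappa.
Proof.
have nu0 := lt0r_neq0 (nu_gt0 i); have nuC0 := lt0r_neq0 (nuC_gt0 i).
have -> : m i / q i - m i * q i = (m i * (1 - 2 * nu i)) / (nu i * (1 - nu i)).
  by rewrite /hit; field; rewrite nu0 nuC0.
by rewrite m_nu mulfK // mulf_neq0.
Qed.

(** Termwise, [m i * (1 - q i) = kappa * nu i]: the chance of leaving by [i] and never returning. *)
Lemma sum_hit : \sum_(i < 3) m i * q i = 1 - kappa.
Proof.
suff : \sum_(i < 3) (m i - m i * q i) = kappa by rewrite sumrB m_sum; lra.
rewrite -[RHS]mulr1 -nu_sum mulr_sumr; apply: eq_bigr => i _.
have nuC0 := lt0r_neq0 (nuC_gt0 i).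
have -> : m i - m i * q i = (m i * (1 - 2 * nu i)) / (1 - nu i).
  by rewrite /hit; field.
by rewrite m_nu mulrA mulfK.
Qed.

Lemma lstep_hit1 g : word g = [::] -> lstep m Q g = 1 - kappa.
Proof. by move=> g0; rewrite lstep_letter_prod1 // sum_hit. Qed.

Lemma lstep_hit g j s : word g = j :: s -> lstep m Q g = Q g.
Proof.
move=> gs; rewrite (lstep_letter_prod _ _ gs) ?lt0r_neq0 ?hit_gt0 //.
by rewrite hit_kappa sum_hit subrKC mulr1.
Qed.

Lemma lstep_hit_le g : lstep m Q g <= 1 * Q g.
Proof.
case E : (word g) => [|j s]; last by rewrite (lstep_hit E) mul1r.
by rewrite lstep_hit1 // /letter_prod E big_nil mul1r; have := kappa_gt0; lra.
Qed.

Lemma mass_le_hit n g : mass m n g <= Q g.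
Proof. exact: (mass_le_letter_prod m_ge0 hit_gt0 lstep_hit_le). Qed.

(* [Q] is harmonic off 1, and so is the constant 1; by strict convexity of
   [t |-> q ^ t] the intermediate power [sqrt Q] is contracted by the walk. *)
Lemma expect_hit_cvg0 : expect m n Q @[n --> \oo] --> 0.
Proof.
pose w i := Num.sqrt (q i).
have w_gt0 i : 0 < w i by rewrite sqrtr_gt0 hit_gt0.
have wE i : w i ^+ 2 = q i by rewrite sqr_sqrtr // ltW // hit_gt0.
have w_lt1 i : w i < 1.
  by rewrite -(@ltr_pXn2r _ 2) ?nnegrE ?ler01 ?(ltW (w_gt0 i)) // wE expr1n hit_lt1.
(* Off 1 the factor is [m j / w j - m j * w j] plus this sum, and that difference is at most half of
   [m j / q j - m j * q j = kappa]. *)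
pose lam := \sum_(i < 3) m i * w i + kappa / 2.
have lam_gt0 : 0 < lam.
  rewrite ltr_wpDl // ?divr_gt0 ?kappa_gt0 //.
  by apply: sumr_ge0 => i _; rewrite mulr_ge0 // ltW.
have lam_lt1 : lam < 1.
  (* This sum equals [2 * (1 - lam)]. *)
  have : 0 < \sum_(i < 3) m i * (1 - w i) ^+ 2.
    rewrite (bigD1 ord0) //= ltr_pwDl //.
      by rewrite mulr_gt0 // exprn_gt0 // subr_gt0.
    by apply: sumr_ge0 => i _; rewrite mulr_ge0 // sqr_ge0.
  rewrite (eq_bigr (fun i => m i + (m i * q i + (- 2) * (m i * w i)))); last first.
    by move=> i _; rewrite -wE; ring.
  by rewrite !big_split /= -mulr_sumr m_sum sum_hit /lam; lra.
have w_super g : lstep m (letter_prod w) g <= lam * letter_prod w g.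
  case E : (word g) => [|j s].
    rewrite lstep_letter_prod1 // /letter_prod E big_nil mulr1.
    by rewrite lerDl ltW // divr_gt0 // kappa_gt0.
  rewrite (lstep_letter_prod _ _ E) ?lt0r_neq0 // mulrC ler_wpM2r //.
    exact/ltW/letter_prod_gt0.
  rewrite addrC lerD2l -(hit_kappa j) -wE.
  have wj0 := lt0r_neq0 (w_gt0 j).
  rewrite -subr_ge0 (_ : _ - _ =
    m j * (1 - w j) ^+ 3 * (1 + w j) / (2 * w j ^+ 2)); last by field.
  rewrite divr_ge0 ?mulr_ge0 ?sqr_ge0 ?exprn_ge0 ?subr_ge0 // ?ltW //.
  by rewrite addr_gt0.
apply: (@squeeze_cvgr _ _ _ _ (fun=> 0) (fun n => lam ^+ n)).
- near=> n; rewrite -{1}(expect_cst m_sum n 0) ler_expect //= => [|g].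
    apply: le_trans (expect_letter_prod_le m_ge0 w_super _ _); last exact: ltW.
    apply: ler_expect => // g; apply: ler_prod => i _.
    by rewrite ltW ?hit_gt0 //= -wE expr2 ler_piMl ?ltW.
  exact/ltW/letter_prod_gt0/hit_gt0.
- exact: cvg_cst.
- by apply: cvg_expr; rewrite ger0_norm // ltW.
Unshelve. all: by end_near. Qed.

(* The probability that the limit of the walk started at [g^-1] begins with the
   letter [i]. *)
Let ending (i : 'I_3) (g : freeprod) : R :=
  (ends_with i g)%:R + Q g * (nu i - (ends_with i g)%:R).

(** The walk from [g^-1] hits 1 with probability [Q g] and then restarts; otherwise its first letter
    is kept forever. A left step changes the last letter only of words of length at most 1, so
    longer words inherit the harmonicity of [Q]. *)
Lemma lstep_ending i g : lstep m (ending i) g = ending i g.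
Proof.
pose F s : R := (ohead (rev s) == Some i)%:R +
  (\prod_(j <- s) q j) * (nu i - (ohead (rev s) == Some i)%:R).
have nuC0 := lt0r_neq0 (nuC_gt0 i).
have mq : m i - m i * q i = kappa * nu i.
  rewrite (_ : m i - m i * q i = (m i * (1 - 2 * nu i)) / (1 - nu i)).
    by rewrite m_nu mulrA mulfK.
  by rewrite /hit; field.
have qnu : q i * (nu i - 1) = - nu i by rewrite /hit; field.
have eqS (j k : 'I_3) : (Some j == Some k) = (j == k) by [].
case E : (word g) => [|j [|k s]].
- rewrite (lstep_nil m F E) // /ending /ends_with /letter_prod E !big_nil.
  rewrite (bigD1 i) //= {1}/F eqS eqxx big_seq1.
  rewrite (eq_bigr (fun j => (m j * q j) * nu i)) => [|j ji]; last first.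
    by rewrite /F eqS (negbTE ji) big_seq1 add0r subr0 mulrA.
  rewrite -mulr_suml sum_neq sum_hit.
  by move=> /=; lra.
- rewrite (lstep_cons m F E) /ending /ends_with /letter_prod E.
  rewrite big_seq1 /= eqS.
  rewrite (eq_bigr (fun h => m h * (j == i)%:R +
     (m h * q h) * (q j * (nu i - (j == i)%:R)))) => [|h ji]; last first.
    by rewrite /F !big_cons big_nil eqS; ring.
  rewrite big_split /= -!mulr_suml !sum_neq m_sum sum_hit {1}/F big_nil /=.
  case: (eqVneq j i) => [->|ji] /=.
    rewrite qnu.
    have : m i * (q i * (nu i - 1)) = m i * - nu i by rewrite qnu.
    by lra.
  have := hit_kappa j; have := lt0r_neq0 (hit_gt0 j) => qj0 qk.
  rewrite -qk; by field.
- have re (h l : 'I_3) t : ohead (rev (h :: l :: t)) = ohead (rev (l :: t)).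
    rewrite [rev (h :: _)]rev_cons; case: (rev _) (size_rev (l :: t)) => //.
  rewrite (lstep_cons m F E) /ending /ends_with E.
  rewrite -(lstep_hit E) (lstep_cons m (fun s => \prod_(i <- s) q i) E) re.
  set e : R := (_ == _)%:R.
  rewrite (eq_bigr (fun h => m h * e +
     m h * (\prod_(l <- [:: h, j, k & s]) q l) * (nu i - e))); last first.
    by move=> h _; rewrite /F !re -/e mulrDr mulrA.
  rewrite big_split /= -!mulr_suml sum_neq m_sum /F -/e.
  by ring.
Qed.

(** The harmonic function [ending i] has value [nu i] at 1, hence expectation [nu i] at all times.
    It differs from the indicator of [ends_with i] by at most [Q], and inversion turns last letters
    into first ones. *)
Lemma expect_starts_with i n :
  `|expect m n (fun g => (starts_with i g)%:R) - nu i| <= expect m n Q.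
Proof.
have <- : expect m n (ending i) = nu i.
  elim: n => [|n IH].
    by rewrite /expect /ending /ends_with /letter_prod /= big_nil; ring.
  by rewrite expectSr -[RHS]IH; congr (expect _ _ _); apply/funext/lstep_ending.
rewrite -(expect_inv _ n (ending i)) -expectB.
rewrite (le_trans (ler_norm_expect m_ge0 _ _)) //.
rewrite -[leRHS]expect_inv ler_expect // => g.
rewrite /ending ends_withV opprD addNKr normrN normrM ger0_norm.
  rewrite ler_piMr //; first exact/ltW/letter_prod_gt0/hit_gt0.
  case: (starts_with i g); have := nu_gt0 i; have := nu_lt i => nul nug /=.
    by rewrite ler0_norm; lra.
  by rewrite ger0_norm; lra.
exact/ltW/letter_prod_gt0/hit_gt0.
Qed.

Lemma expect_starts_with_cvg i :
  expect m n (fun g => (starts_with i g)%:R) @[n --> \oo] --> nu i.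
Proof.
apply/subr_cvg0/cvgr0Pnorm_le => e e0.
move/cvgr0Pnorm_le: expect_hit_cvg0 => /(_ e e0); apply: filterS => n.
by apply: le_trans; rewrite (le_trans (expect_starts_with i n)) // ler_norm.
Qed.

(** The increments of the expectation converge by [expect_starts_with_cvg], so their Cesaro means
    have the same limit, which [m_nu] rewrites in terms of [nu]. *)
Lemma expect_letter_sum_cvg (a : 'I_3 -> R) :
  n%:R^-1 * expect m n (letter_sum a) @[n --> \oo] -->
  kappa * \sum_(i < 3) a i * (nu i * (1 - nu i)).
Proof.
pose u n := \sum_(i < 3) m i * a i *
  (1 - 2 * expect m n (fun g => (starts_with i g)%:R)).
have uS n : series u n = expect m n (letter_sum a).
  elim: n => [|n IH]; first by rewrite /expect /letter_sum /series /= big_geq ?big_nil.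
  rewrite seriesSr IH expectSr.
  have -> := funext (lstep_letter_sum m_sum a).
  rewrite expectD expect_sum; congr (_ + _); apply: eq_bigr => i _.
  by rewrite expectZ expectB expectZ expect_cst.
have ucvg : u @ \oo --> kappa * \sum_(i < 3) a i * (nu i * (1 - nu i)).
  rewrite (_ : _ * _ = \sum_(i < 3) m i * a i * (1 - 2 * nu i)); last first.
    rewrite mulr_sumr; apply: eq_bigr => i _.
    by rewrite mulrAC m_nu mulrCA mulrC -mulrA mulrCA; ring.
  apply: cvg_big => [|i _]; first exact: add_continuous.
  apply: cvgM; first exact: cvg_cst.
  apply: cvgB; first exact: cvg_cst.
  by apply: cvgM; [exact: cvg_cst|exact: expect_starts_with_cvg].
(* The shift matches [arithmetic_mean], whose term of index [n] divides by [n.+1]. *)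
rewrite -cvg_shiftS /=.
rewrite (_ : (fun _ => _) = arithmetic_mean u); first exact: cesaro.
by apply/funext => n; rewrite /arithmetic_mean -uS.
Qed.


(** * Entropy *)

(* Since [nu i = (1 - nu i) * q i] sums to 1, the weight
   [(1 - nu (first letter)) * Q] has total mass 1 on every sphere. *)
Let sphere_weight (s : seq 'I_3) : R :=
  if s is i :: _ then (1 - nu i) * \prod_(j <- s) q j else 1.

(** The letters allowed before [j] have total [nu]-mass [1 - nu j], the very coefficient of words
    starting with [j]. *)
Let sum_sphere_weight n : \sum_(s <- sphere_words n) sphere_weight s = 1.
Proof.
have nuE i : (1 - nu i) * q i = nu i by rewrite mulrC divfK // lt0r_neq0.
elim: n => [|n IH]; first by rewrite big_seq1.
rewrite big_sphere_wordsS -[RHS]IH; apply: eq_bigr => -[|j s] _ /=.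
  rewrite -[RHS]nu_sum; apply: eq_bigr => i _; by rewrite big_seq1 nuE.
rewrite (eq_bigr (fun i => nu i * \prod_(k <- j :: s) q k)) => [|i _].
  rewrite -mulr_suml (eq_bigl (fun i => i != j)) => [|i].
    by rewrite sum_neq nu_sum.
  by rewrite eq_sym.
by rewrite big_cons mulrA nuE.
Qed.

(** The coefficient [1 - nu j] exceeds 1/2, so [Q] is at most twice the weight, whose mass is 1 on
    each of the [n.+1] spheres. *)
Lemma sum_ball_hit n : \sum_(g <- word_ball n) Q g <= 2 * n.+1%:R.
Proof.
rewrite -(big_map word predT (fun s => \prod_(i <- s) q i)) map_word_ball.
have -> : n.+1%:R = \sum_(s <- ball_words n) sphere_weight s.
  elim: n => [|n IH]; first by rewrite big_seq1.
  by rewrite ball_wordsS big_cat /= -IH (sum_sphere_weight n.+1) natr1.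
rewrite mulr_sumr; apply: ler_sum => -[|j s] _; first by rewrite big_nil /=; lra.
have Q0 : 0 < \prod_(i <- j :: s) q i by apply: prodr_gt0 => i _; exact: hit_gt0.
by rewrite /= mulrA ler_peMl ?(ltW Q0) //; have := nu_lt j; lra.
Qed.

Lemma ln_hitE g : - ln (Q g) = letter_sum (fun i => - ln (q i)) g.
Proof.
rewrite /letter_prod /letter_sum; elim: (word g) => [|i s IH].
  by rewrite !big_nil ln1 oppr0.
rewrite !big_cons -IH lnM ?posrE ?hit_gt0 ?opprD //.
by apply: prodr_gt0 => j _; exact: hit_gt0.
Qed.

Lemma entropy_ge n : expect m n (letter_sum (fun i => - ln (q i))) <=
  - expect m n (fun g => ln (mass m n g)).
Proof.
rewrite -!sum_ball -sumrN; apply: ler_sum => g _.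
rewrite -mulrN; have := mass_ge0 m_ge0 m_sum n g; rewrite le_eqVlt => /predU1P[<-|g0].
  by rewrite !mul0r.
by rewrite ler_pM2l // -ln_hitE lerN2 ler_ln ?posrE ?letter_prod_gt0 ?mass_le_hit //;
  exact: hit_gt0.
Qed.

(* Gibbs' inequality *)
Lemma entropy_le n :
  - expect m n (fun g => ln (mass m n g)) <=
  expect m n (letter_sum (fun i => - ln (q i))) + ln (2 * n.+1%:R).
Proof.
pose Z : R := 2 * n.+1%:R; rewrite -/Z.
have Z0 : 0 < Z by rewrite mulr_gt0.
have Qg0 g : 0 < Q g by exact/letter_prod_gt0/hit_gt0.
have m1 : \sum_(g <- word_ball n) mass m n g = 1.
  rewrite -[RHS](expect_cst m_sum n 1) -sum_ball.
  by apply: eq_bigr => g _; rewrite mulr1.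
have -> : ln Z = \sum_(g <- word_ball n) mass m n g * ln Z by rewrite -mulr_suml m1 mul1r.
rewrite -!sum_ball -sumrN -big_split /= -subr_ge0.
(* [Q / Z] is a subprobability on the ball, to be compared with the law of the walk. *)
have : 0 <= 1 - \sum_(g <- word_ball n) Q g / Z.
  by rewrite -mulr_suml subr_ge0 ler_pdivrMr // mul1r sum_ball_hit.
move/le_trans; apply; rewrite -{1}m1 -!sumrB; apply: ler_sum => g _.
rewrite -ln_hitE; have := mass_ge0 m_ge0 m_sum n g; rewrite le_eqVlt => /predU1P[<-|g0].
  by rewrite !mul0r; have := divr_ge0 (ltW (Qg0 g)) (ltW Z0); lra.
set x := Q g / Z / mass m n g.
have x0 : 0 < x by rewrite !divr_gt0.
have lnx : ln x = ln (Q g) - ln Z - ln (mass m n g).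
  by rewrite !ln_div ?posrE ?divr_gt0.
have /le_ln1Dx : - 1 < x - 1 by rewrite ltrBrDr addNr.
rewrite subrKC lnx => /(ler_wpM2l (ltW g0)).
have -> : mass m n g * (x - 1) = Q g / Z - mass m n g.
  by rewrite /x; field; rewrite !lt0r_neq0.
by lra.
Qed.

End HarmonicMeasure.

(** * Volume and entropy as limits *)

(** The logarithm telescopes into increments bounded by the harmonic sequence, so it is a Cesaro
    mean of a null sequence. *)
Lemma cvg_ln_div_nat (R : realType) : n%:R^-1 * ln (n.+1%:R : R) @[n --> \oo] --> 0.
Proof.
pose u n : R := ln n.+2%:R - ln n.+1%:R.
have ucvg : u @ \oo --> 0.
  apply: (squeeze_cvgr _ (cvg_cst 0) (@cvg_harmonic R)).
  near=> n; rewrite /u -ln_div ?posrE //; apply/andP; split.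
    by rewrite ln_ge0 // ler_pdivlMr // mul1r ler_nat.
  have -> : n.+2%:R / n.+1%:R = 1 + harmonic n :> R.
    by rewrite /harmonic -[n.+2%:R]natr1 mulrDl divff // mul1r.
  by apply: le_ln1Dx; rewrite (lt_trans (ltrN10 R)) // harmonic_gt0.
rewrite -cvg_shiftS /= (_ : (fun _ => _) = arithmetic_mean u); first exact: cesaro.
apply/funext => n; rewrite /arithmetic_mean; congr (_ * _).
by rewrite /series /= telescope_sumr // ln1 subr0.
Unshelve. all: by end_near. Qed.

Lemma cvg_invn_mul (R : realType) (c : R) : n%:R^-1 * c @[n --> \oo] --> 0.
Proof.
rewrite -cvg_shiftS; have /= := cvgM (@cvg_harmonic R) (cvg_cst c).
rewrite mul0r; exact.
Qed.

Lemma volume_Sigma (R : realType) : volume Sigma R = ln 2.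
Proof.
apply/cvg_lim => //.
apply: (@squeeze_cvgr _ _ _ _ (fun=> ln 2) (fun n => n%:R^-1 * ln 3 + ln 2)).
- near=> n; have n0 : n%:R != 0 :> R by rewrite pnatr_eq0 -lt0n; near: n; exists 1%N.
  have E : ln 2 = n%:R^-1 * ln ((2 ^ n)%:R : R).
    by rewrite natrX lnXn // -[X in _ * X]mulr_natl mulKf.
  have e2 : (0 < 2 ^ n)%N by rewrite expn_gt0.
  rewrite ball_cardE size_word_ball [X in X <= _]E [X in _ + X]E -mulrDr.
  rewrite -lnM ?posrE ?ltr0n // -natrM.
  by rewrite !ler_wpM2l ?invr_ge0 // ler_ln ?posrE ?ltr0n ?ler_nat //; lia.
- exact: cvg_cst.
- have /= := cvgD (cvg_invn_mul (ln 3)) (cvg_cst (ln 2 : R)).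
  rewrite add0r; exact.
Unshelve. all: by end_near. Qed.

(** [entropy_ge] and [entropy_le] enclose the entropy of the n-th law up to [ln (2 * n.+1%:R)],
    negligible after division by [n]. *)
Lemma entropy_letter_law (R : realType) (m nu : 'I_3 -> R) (kappa : R) :
  (forall i, 0 < m i) -> \sum_(i < 3) m i = 1 ->
  (forall i, 0 < nu i) -> (forall i, nu i < 2^-1) -> \sum_(i < 3) nu i = 1 ->
  (forall i, m i * (1 - 2 * nu i) = kappa * (nu i * (1 - nu i))) ->
  entropy (letter_law m) =
  kappa * \sum_(i < 3) - ln (hit nu i) * (nu i * (1 - nu i)).
Proof.
move=> m0 m1 nu0 nul nu1 mnu; apply/cvg_lim => //.
have L := expect_letter_sum_cvg m0 m1 nu0 nul nu1 mnu (a := fun i => - ln (hit nu i)).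
pose l n := n%:R^-1 * expect m n (letter_sum (fun i => - ln (hit nu i))).
apply: (@squeeze_cvgr _ _ _ _ l
  (fun n => l n + (n%:R^-1 * ln 2 + n%:R^-1 * ln n.+1%:R))) => //.
- near=> n; rewrite entropy_sumE -mulrN -!mulrDr -lnM ?posrE ?ltr0n //.
  rewrite !ler_wpM2l ?invr_ge0 //.
    exact: (entropy_le m0 m1 nu0 nul nu1).
  exact: (entropy_ge m0 m1 nu0 nul nu1 mnu).
- have /= := cvgD L (cvgD (cvg_invn_mul (ln 2)) (@cvg_ln_div_nat R)).
  rewrite !addr0; exact.
Unshelve. all: by end_near. Qed.

(** * The drift of a random walk with independent increments *)

Lemma countable_freeprod : countable [set: freeprod].
Proof.
apply/countable_injP; exists (choice.pickle \o word) => g h _ _ /=.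
by move/(pcan_inj choice.pickleK)/word_inj.
Qed.

Lemma size_word_rmul i g : (size (word (g * letter i)%g) <= (size (word g)).+1)%N.
Proof.
have sV h : size (word (h^-1)%g) = size (word h) by rewrite /= size_rev.
by rewrite -sV invgM letterV -(sV g); exact: size_word_lmul.
Qed.

Section Drift.
Variables (R : realType) (m : 'I_3 -> R).
Hypothesis m_ge0 : forall i, 0 <= m i.
Hypothesis m_sum : \sum_(i < 3) m i = 1.
Variables (d : measure_display) (T : measurableType d) (P : probability T R).
Variable x : nat -> T -> freeprod.
Hypothesis iid_x : iid P (letter_law m) x.

Local Lemma measurable_step n (A : set freeprod) : measurable (x n @^-1` A).
Proof. by have [+ _ _] := iid_x; exact. Qed.

Local Lemma step_law n i : P (x n @^-1` [set letter i]) = (m i)%:E.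
Proof. by have [_ + _] := iid_x => ->. Qed.

Local Lemma trivIset_step n :
  trivIset [set: 'I_3] (fun i => x n @^-1` [set letter i]).
Proof. by move=> i j _ _ [w [/= -> /letter_inj]]. Qed.

(** The event that the n-th increment is a letter, which [iid] grants only almost surely. *)
Let steps n : set T := \big[setU/set0]_(i < 3) (x n @^-1` [set letter i]).

Local Lemma stepsP n w : steps n w <-> exists i, x n w = letter i.
Proof.
rewrite /steps -bigcup_seq; split=> [[i _ /= xi]|[i xi]]; exists i => //=.
by rewrite mem_index_enum.
Qed.

Local Lemma measurable_steps n : measurable (steps n).
Proof. by apply: bigsetU_measurable => i _; exact: measurable_step. Qed.

Local Lemma stepsC0 n : P (~` steps n) = 0%E.
Proof.
rewrite probability_setC; last exact: measurable_steps.
rewrite measure_bigsetU_ord; [|by move=> i; exact: measurable_step|exact: trivIset_step].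
rewrite (eq_bigr (fun i => (m i)%:E)) => [|i _]; last exact: step_law.
by rewrite sumEFin m_sum -EFinB subrr.
Qed.

Local Lemma split_step n (E : set T) : measurable E ->
  P E = (\sum_(i < 3) P (E `&` x n @^-1` [set letter i]))%E.
Proof.
move=> mE; rewrite (measureDI P mE (measurable_steps n)).
rewrite [X in (X + _)%E](_ : _ = 0%E) ?add0e; last first.
  apply: (@subset_measure0 _ _ _ _ _ (~` steps n)).
  - by apply: measurableD => //; exact: measurable_steps.
  - by apply: measurableC; exact: measurable_steps.
  - by move=> w [].
  - exact: stepsC0.
rewrite /steps big_distrr /= measure_bigsetU_ord //.
  by move=> i; apply: measurableI => //; exact: measurable_step.
by apply: trivIset_setIl; exact: trivIset_step.
Qed.

Lemma measurable_walk n (A : set freeprod) : measurable (walk x n @^-1` A).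
Proof.
elim: n A => [|n IH] A.
  by rewrite [X in measurable X]preimage_cst; case: ifP => _.
rewrite (_ : _ @^-1` A = \bigcup_g (walk x n @^-1` [set g] `&`
    x n @^-1` [set h | A (g * h)%g])).
  apply: (countable_bigcupT_measurable countable_freeprod) => g.
  by apply: measurableI => //; exact: measurable_step.
apply/seteqP; split=> w /=; first by exists (walk x n w).
by case=> g _ [/= ->].
Qed.

(** Later increments are carried along so that the induction can move the n-th one from the walk
    into the family [J]. *)
Lemma walk_indep n g (J : {fset nat}) (A : nat -> set freeprod) :
  (forall j, j \in J -> n <= j)%N ->
  P (walk x n @^-1` [set g] `&` \bigcap_(j in [set` J]) (x j @^-1` A j)) =
  ((mass m n g)%:E * \prod_(j <- J) P (x j @^-1` A j))%E.
Proof.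
have mcap (K : {fset nat}) B : measurable (\bigcap_(j in [set` K]) (x j @^-1` B j)).
  by apply: fin_bigcap_measurable => [|j _]; [exact: finite_fset|exact: measurable_step].
have [_ _ ind] := iid_x.
elim: n g J A => [|n IH] g J A nJ.
  rewrite /mass /expect /=; case: eqP => [<-|g1].
    by rewrite mul1e -ind; congr (P _); apply/seteqP; split=> w; [case|].
  rewrite mul0e -[RHS](measure0 P); congr (P _).
  by apply/seteqP; split=> w // -[/= /g1].
have nJn : n \notin J by apply: contraT => /negPn/nJ; rewrite ltnn.
rewrite (split_step n); last by apply: measurableI => //; exact: measurable_walk.
rewrite massS -sumEFin ge0_sume_distrl; last first.
  by move=> i _; rewrite lee_fin mulr_ge0 // (mass_ge0 m_ge0 m_sum).
apply: eq_bigr => i _.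
pose B j := if j == n then [set letter i] else A j.
transitivity (P (walk x n @^-1` [set (g * letter i)%g] `&`
    \bigcap_(j in [set` (n |` J)%fset]) (x j @^-1` B j))).
  congr (P _); rewrite bigcap_fsetU1 {1}/B eqxx.
  have -> : \bigcap_(j in [set` J]) (x j @^-1` B j) =
            \bigcap_(j in [set` J]) (x j @^-1` A j).
    apply: eq_bigcapr => j /= jJ; rewrite /B; case: eqP => // jn.
    by rewrite -jn jJ in nJn.
  apply/seteqP; split=> w /= [].
    by case=> gE ? xE; split=> //; rewrite -gE xE letterKr.
  by move=> gE [xE ?]; split=> //; split=> //; rewrite gE xE letterKr.
rewrite IH => [|j]; last first.
  by rewrite in_fset1U => /predU1P[->//|/nJ/ltnW].
rewrite big_fsetU1 //= /B eqxx step_law muleA -EFinM (mulrC (mass _ _ _)).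
congr (_ * _)%E; apply: eq_big_seq => j jJ; case: eqP => // jn.
by rewrite -jn jJ in nJn.
Qed.

Lemma walk_law n g : P (walk x n @^-1` [set g]) = (mass m n g)%:E.
Proof.
have := @walk_indep n g fset0 (fun=> setT).
rewrite big_nil mule1 => <- //; congr (P _).
by apply/seteqP; split=> w => [|[]].
Qed.

Lemma walk_ball_ae : {ae P, forall w n, (size (word (walk x n w)) <= n)%N}.
Proof.
have : {ae P, forall w n, steps n w}.
  apply: ae_foralln => n; exists (~` steps n); split => //.
    by apply: measurableC; exact: measurable_steps.
  exact: stepsC0.
apply: filterS => w sw; elim=> // n IH.
have [i /= ->] := (stepsP n w).1 (sw n).
exact: leq_trans (size_word_rmul _ _) _.
Qed.

(** Almost surely the length of [X_n] is at most [n], so dominated convergence turns the almost sure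
    limit into a limit of expectations. *)
Lemma drift_expect gamma : is_drift P Sigma x gamma ->
  n%:R^-1 * expect m n (letter_sum (fun=> 1)) @[n --> \oo] --> gamma.
Proof.
move=> hgamma.
pose len g : R := (size (word g))%:R.
have lenE : letter_sum (fun=> 1) = len.
  by apply/funext => g; rewrite /letter_sum big_const_seq count_predT iter_addr_0.
pose term n g w : \bar R :=
  ((len g / n%:R)%:E * (\1_(walk x n @^-1` [set g]) w)%:E)%E.
(* The normalised length, cut to 0 outside the ball: a finite sum of indicators, integrated by
   [walk_law]. *)
pose f n w : \bar R := (\sum_(g <- word_ball n) term n g w)%E.
have f_in n w : (size (word (walk x n w)) <= n)%N -> f n w = (len (walk x n w) / n%:R)%:E.
  move=> wn; rewrite /f /term (bigD1_seq (walk x n w)) ?word_ball_uniq ?mem_word_ball //=.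
  rewrite indicE mem_set // mule1 big1 ?adde0 // => g.
  by rewrite indicE => gw; rewrite memNset ?mule0 //= => /esym/eqP; rewrite (negbTE gw).
have f_out n w : (n < size (word (walk x n w)))%N -> f n w = 0%E.
  move=> wn; rewrite /f /term big_seq big1 // => g; rewrite mem_word_ball indicE => gn.
  rewrite memNset ?mule0 //= => gw; by rewrite gw ltnNge gn in wn.
have mterm n g : measurable_fun [set: T] (term n g).
  apply/measurable_funeM/measurable_EFinP/measurable_indic.
  exact: measurable_walk.
have intf n : (\int[P]_w f n w = (n%:R^-1 * expect m n len)%:E)%E.
  rewrite ge0_integral_sum //; last first.
    by move=> g w _; rewrite mule_ge0 // lee_fin divr_ge0.
  rewrite -sum_ball mulr_sumr -sumEFin; apply: eq_bigr => g _.
  rewrite ge0_integralZl_EFin //; last 2 first.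
  - by apply/measurable_EFinP/measurable_indic; exact: measurable_walk.
  - by rewrite divr_ge0.
  rewrite integral_indic //; last exact: measurable_walk.
  transitivity ((len g / n%:R)%:E * (mass m n g)%:E)%E.
    by rewrite setIT; congr (_ * _)%E; exact: walk_law.
  by rewrite -EFinM; congr EFin; ring.
have [|||||_ _ cvgf] := @dominated_convergence _ _ _ P setT measurableT f
    (cst gamma%:E) (cst 1%E).
- by move=> n; apply: emeasurable_sum => g; exact: mterm.
- exact: measurable_cst.
- apply: filterS2 walk_ball_ae hgamma => w wn /= cvgw _.
  have -> : f ^~ w = EFin \o (fun n => (word_length Sigma (walk x n w))%:R / n%:R).
    by apply/funext => n /=; rewrite f_in // word_length_freeprod.
  by apply: cvg_EFin => //; exact: nearW.
- exact: finite_measure_integrable_cst.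
- apply: aeW => w n _; have [wn|wn] := leqP (size (word (walk x n w))) n.
    rewrite f_in //= lee_fin ger0_norm ?divr_ge0 //.
    (* At time 0 the quotient is 0, since the inverse of 0 is 0. *)
    case: n wn => [|n] wn; first by rewrite invr0 mulr0 ler01.
    by rewrite ler_pdivrMr // mul1r ler_nat.
  by rewrite f_out // abse0 lee_fin ler01.
have intc : (\int[P]_w cst gamma%:E w = gamma%:E)%E.
  rewrite integral_cst // -[RHS]mule1; congr (_ * _)%E; exact: probability_setT.
move: cvgf; rewrite intc lenE => /fine_cvg.
rewrite (_ : fine \o _ = fun n => n%:R^-1 * expect m n len); first exact.
by apply/funext => n /=; rewrite intf.
Qed.

End Drift.

(** * The measures [mu_abc p] *)

Section AbcWeights.
Variable R : realType.

Definition abc_weight (u v : R) (i : 'I_3) : R := if i == ord_max then v else u.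

Lemma sum_abc_weight (f : R -> R -> R) u v u' v' :
  \sum_(i < 3) f (abc_weight u v i) (abc_weight u' v' i) = 2 * f u u' + f v v'.
Proof. by rewrite !big_ord_recr big_ord0 /= add0r /abc_weight /=; ring. Qed.

Lemma mu_abcE p : mu_abc p = letter_law (abc_weight p (1 - 2 * p)).
Proof.
apply/funext => g; rewrite /mu_abc /letter_law -!val_eqE /= /abc_weight.
by case: (word g) => [|[[|[|[|//]]] i3] [|j s]].
Qed.

Lemma ln_lt_subr1 (y : R) : 0 < y -> y != 1 -> ln y < y - 1.
Proof.
move=> y0 y1; have : ln y != 0 by rewrite ln_eq0.
by move/expR_gt1Dx; rewrite lnK ?posrE //; lra.
Qed.

(* [s] is the hitting measure of the letters a and b. *)
Lemma exists_hitting (p : R) : 0 < p < 2^-1 ->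
  exists s, [/\ 4^-1 < s, s < 2^-1 & 2 * p * s = (1 - s) * (4 * s - 1)].
Proof.
(* [D] is the discriminant of [4 s^2 - (5 - 2p) s + 1]. The smaller root is taken; [lt1] and [lt2]
   place it above 1/4 and below 1/2. *)
move=> /andP[p0 p1]; pose D : R := (5 - 2 * p) ^+ 2 - 16.
have D0 : 0 <= D.
  have -> : D = (1 - 2 * p) * (9 - 2 * p) by rewrite /D; ring.
  by rewrite mulr_ge0 //; lra.
have rD : Num.sqrt D ^+ 2 = D by rewrite sqr_sqrtr.
have rD0 : 0 <= Num.sqrt D by exact: sqrtr_ge0.
have lt1 : Num.sqrt D < 3 - 2 * p.
  rewrite -(@ltr_pXn2r _ 2) ?nnegrE //; last by lra.
  by rewrite rD /D; nra.
have lt2 : 1 - 2 * p < Num.sqrt D.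
  rewrite -(@ltr_pXn2r _ 2) ?nnegrE //; last by lra.
  by rewrite rD /D; nra.
exists ((5 - 2 * p - Num.sqrt D) / 8); split; [lra|lra|].
have -> : 2 * p * ((5 - 2 * p - Num.sqrt D) / 8) =
  (1 - (5 - 2 * p - Num.sqrt D) / 8) * (4 * ((5 - 2 * p - Num.sqrt D) / 8) - 1)
  + (Num.sqrt D ^+ 2 - D) / 16 by rewrite /D; field.
by rewrite rD; lra.
Qed.

(* In the limiting word b is followed by a with probability s/(1-s) and by c with
   probability (1-2s)/(1-s), and symmetrically for a, while c is followed by a
   or b with equal probabilities; the defect of the entropy is a multiple of the
   relative entropy of the former law with respect to the fair one. *)
Lemma entropy_defect (s : R) : 4^-1 < s < 2^-1 ->
  2 * (- ln (s / (1 - s)) * (s * (1 - s))) +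
     - ln ((1 - 2 * s) / (2 * s)) * ((1 - 2 * s) * (2 * s)) =
  (2 * (s * (1 - s)) + (1 - 2 * s) * (2 * s)) * ln 2 <-> s = 3^-1.
Proof.
move=> /andP[s1 s2].
have [s0 c0 d0] : [/\ 0 < s, 0 < 1 - s & 0 < 1 - 2 * s] by split; lra.
rewrite !ln_div ?lnM ?posrE ?mulr_gt0 //.
set L := ln 2; set l1 := ln s; set l2 := ln (1 - s); set l3 := ln (1 - 2 * s).
(* The arguments of these logarithms are the ratios of 1/2 to the transition probabilities
   [s / (1 - s)] and [(1 - 2 * s) / (1 - s)]. *)
have lny : ln ((1 - s) / (2 * s)) = l2 - (L + l1).
  by rewrite ln_div ?lnM ?posrE ?mulr_gt0.
have lnz : ln ((1 - s) / (2 * (1 - 2 * s))) = l2 - (L + l3).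
  by rewrite ln_div ?lnM ?posrE ?mulr_gt0.
have sn0 : s != 0 by rewrite lt0r_neq0.
have dn0 : 1 - 2 * s != 0 by rewrite lt0r_neq0.
have [s3|s3] := eqVneq s 3^-1.
  split=> // _; move: lny lnz.
  have -> : (1 - s) / (2 * s) = 1 by rewrite s3; field.
  have -> : (1 - s) / (2 * (1 - 2 * s)) = 1 by rewrite s3; field.
  by rewrite ln1 s3 => e1 e2; lra.
split=> [e|/eqP]; last by rewrite (negbTE s3).
have ltp (a b : R) : 0 < a -> 0 < b -> a != b -> ln (a / b) < a / b - 1.
  move=> a0 b0 ab; apply: ln_lt_subr1; first exact: divr_gt0.
  by apply: contra ab => /eqP ab; rewrite -(divfK (lt0r_neq0 b0) a) ab mul1r.
have s3' : s - 3^-1 != 0 by rewrite subr_eq0.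
have := ltp (1 - s) (2 * s) c0.
have := ltp (1 - s) (2 * (1 - 2 * s)) c0.
rewrite !mulr_gt0 // lny lnz => /(_ isT) lz /(_ isT) ly.
have {}ly : l2 - (L + l1) < (1 - s) / (2 * s) - 1.
  by apply: ly; apply: contraNneq s3 => es; apply/eqP; lra.
have {}lz : l2 - (L + l3) < (1 - s) / (2 * (1 - 2 * s)) - 1.
  by apply: lz; apply: contraNneq s3 => es; apply/eqP; lra.
move: ly; rewrite -(ltr_pM2l s0) => ly.
move: lz; rewrite -(ltr_pM2l d0) => lz.
have ey : s * ((1 - s) / (2 * s) - 1) = (1 - s) / 2 - s by field.
have ez : (1 - 2 * s) * ((1 - s) / (2 * (1 - 2 * s)) - 1) = (1 - s) / 2 - (1 - 2 * s).
  by field.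
rewrite ey in ly; rewrite ez in lz.
(* The weighted bounds [(1 - s) / 2 - s] and [(1 - s) / 2 - (1 - 2 * s)] add up to 0, both laws
   having mass 1. *)
have : 2 * s * (s * (l2 - (L + l1)) + (1 - 2 * s) * (l2 - (L + l3))) < 0.
  by rewrite pmulr_rlt0 ?mulr_gt0 //; lra.
have -> : 2 * s * (s * (l2 - (L + l1)) + (1 - 2 * s) * (l2 - (L + l3))) =
  2 * (- (l1 - l2) * (s * (1 - s))) +
     - (l3 - (L + l1)) * ((1 - 2 * s) * (2 * s)) -
  (2 * (s * (1 - s)) + (1 - 2 * s) * (2 * s)) * L by ring.
by rewrite e subrr ltxx.
Qed.

End AbcWeights.

Theorem mainTheorem8 (R : realType) (p : R) (hp : 0 < p < 2^-1)
    (d : measure_display) (T : measurableType d) (P : probability T R)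
    (x : nat -> T -> freeprod) (hx : iid P (mu_abc p) x)
    (gamma : R) (hgamma : is_drift P Sigma x gamma) :
  entropy (mu_abc p) / (gamma * volume Sigma R) = 1 <-> p = 3^-1.
Proof.
have [s [s1 s2 ps]] := exists_hitting hp.
have /andP[p0 p1] := hp.
have s0 : 0 < s by lra.
have sn0 := lt0r_neq0 s0.
pose m := abc_weight p (1 - 2 * p).
pose nu := abc_weight s (1 - 2 * s).
(* The value forced by [mnu] at the letter a, once [p] is expressed through [s]. *)
pose kappa := (4 * s - 1) * (1 - 2 * s) / (2 * s ^+ 2).
have kappa0 : 0 < kappa by rewrite divr_gt0 ?mulr_gt0 ?exprn_gt0 //; lra.
have m0 i : 0 < m i by rewrite /m /abc_weight; case: ifP => _; lra.
have m1 : \sum_(i < 3) m i = 1.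
  by rewrite (sum_abc_weight (fun y _ => y) p _ p p); ring.
have nu0 i : 0 < nu i by rewrite /nu /abc_weight; case: ifP => _; lra.
have nul i : nu i < 2^-1 by rewrite /nu /abc_weight; case: ifP => _; lra.
have nu1 : \sum_(i < 3) nu i = 1.
  by rewrite (sum_abc_weight (fun y _ => y) s _ s s); ring.
have pE : p = (1 - s) * (4 * s - 1) / (2 * s) by rewrite -ps; field.
have mnu i : m i * (1 - 2 * nu i) = kappa * (nu i * (1 - nu i)).
  by rewrite /m /nu /abc_weight /kappa pE; case: ifP => _; field.
rewrite mu_abcE -/m in hx *.
have m_ge0 i : 0 <= m i by exact: ltW.
have gammaE : gamma = kappa * \sum_(i < 3) 1 * (nu i * (1 - nu i)).
  have := drift_expect m_ge0 m1 hx hgamma.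
  move/(@cvg_unique _ (@norm_hausdorff _ R^o)); apply.
  exact: (expect_letter_sum_cvg m0 m1 nu0 nul nu1 mnu).
rewrite volume_Sigma (entropy_letter_law m0 m1 nu0 nul nu1 mnu) gammaE.
rewrite (sum_abc_weight (fun y _ => - ln (y / (1 - y)) * (y * (1 - y))) s _ s s).
rewrite (sum_abc_weight (fun y _ => 1 * (y * (1 - y))) s _ s s).
rewrite !mul1r (_ : 1 - (1 - 2 * s) = 2 * s); last by ring.
have V0 : 0 < 2 * (s * (1 - s)) + (1 - 2 * s) * (2 * s).
  by rewrite addr_gt0 ?mulr_gt0 //; lra.
have ln20 : 0 < ln 2 :> R by rewrite ln_gt0 // ltr1n.
set V := (X in kappa * X * ln 2) in V0 *; set h := (X in kappa * X / _).
have hV : kappa * h / (kappa * V * ln 2) = 1 <-> h = V * ln 2.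
  have W0 : kappa * V * ln 2 != 0 by apply/lt0r_neq0/mulr_gt0 => //; exact: mulr_gt0.
  split=> [/(congr1 (fun t => t * (kappa * V * ln 2)))|->].
    by rewrite divfK // mul1r -mulrA => /(mulfI (lt0r_neq0 kappa0)).
  by rewrite mulrA divff.
apply: (iff_trans hV); rewrite entropy_defect ?s1 //.
split=> [s3|p3]; first by rewrite pE s3; field.
move: ps; rewrite p3 => ps.
(* The other root, 3/4, is excluded by [s < 2^-1]. *)
have : (s - 3^-1) * (4 * s - 3) = 0.
  transitivity (2 * 3^-1 * s - (1 - s) * (4 * s - 1)); first by field.
  by rewrite ps subrr.
by move=> /eqP; rewrite mulf_eq0 => /orP[] /eqP; lra.
Qed.
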